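(* Let $\alpha\ge\beta>0$, put $\tau=\alpha/\beta\ge 1$, and let $I$ be a Gamma--Gamma random variable with shape parameters $(\alpha,\beta)$. Then, for sufficiently large $\alpha,\beta$, the skewness $\gamma_{1,\mathrm{GG}}$ and the excess kurtosis $\gamma_{2,\mathrm{GG}}$ of $I$ satisfy $$\gamma_{1,\mathrm{GG}}=\frac{2(\tau^{2}+3\tau+1)}{\sqrt{\tau}\,(\tau+1)^{3/2}}\,\frac{1}{\sqrt{\beta}}+\mathcal{O}\!\left(\beta^{-3/2}\right)$$ and $$\gamma_{2,\mathrm{GG}}=\frac{6(\tau^{2}+5\tau+1)}{\tau(\tau+1)}\,\frac{1}{\beta}+\mathcal{O}\!\left(\beta^{-2}\right).$$ That is, there exist constants $C,\beta_0>0$ such that for all $\alpha\ge\beta\ge\beta_0$ the two remainder terms are bounded in absolute value by $C\beta^{-3/2}$ and $C\beta^{-2}$, respectively.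
   Context: The Gamma--Gamma distribution with shape parameters $\alpha,\beta>0$ is the distribution on $(0,\infty)$ with density $$f_{GG}(x;\alpha,\beta)=\frac{2(\alpha\beta)^{(\alpha+\beta)/2}}{\Gamma(\alpha)\Gamma(\beta)}\,x^{\frac{\alpha+\beta}{2}-1}K_{\alpha-\beta}\!\left(2\sqrt{\alpha\beta x}\right),$$ where $K_\nu$ is the modified Bessel function of the second kind of order $\nu$. Equivalently, $I=XY$ with $X,Y$ independent, $X$ Gamma distributed with shape $\alpha$ and mean $1$, and $Y$ Gamma distributed with shape $\beta$ and mean $1$. Its moments are $$\mathbb{E}[I^k]=\frac{\Gamma(\alpha+k)\Gamma(\beta+k)}{\Gamma(\alpha)\Gamma(\beta)}(\alpha\beta)^{-k};$$ in particular $\mathbb{E}[I]=1$. With $\mu$ and $\sigma$ the mean and standard deviation of $I$, the skewness is $\gamma_{1,\mathrm{GG}}=\mathbb{E}[((I-\mu)/\sigma)^3]$ and the excess kurtosis is $\gamma_{2,\mathrm{GG}}=\mathbb{E}[((I-\mu)/\sigma)^4]-3$. The notation $\mathcal{O}(\beta^{-p})$ denotes a remainder whose magnitude is bounded by a constant multiple of $\beta^{-p}$. *)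

(* Defs.v *)
From HB Require Import structures.
From mathcomp Require Import all_boot all_order all_algebra.
From mathcomp Require Import all_classical all_reals all_analysis.

Set Implicit Arguments.
Unset Strict Implicit.
Unset Printing Implicit Defensive.

Import Order.TTheory GRing.Theory Num.Theory.
Import numFieldNormedType.Exports.

Local Open Scope classical_set_scope.
Local Open Scope ring_scope.

(* Euler's integral; it converges only for 0 < a, the only case used below. *)
Definition Gamma_fun {R : realType} (a : R) : R :=
  \int[lebesgue_measure]_(t in `]0, +oo[) (t `^ (a - 1) * expR (- t)).

Definition cosh {R : realType} (t : R) : R := (expR t + expR (- t)) / 2.

(* Modified Bessel function of the second kind, of real order nu, through its
   standard integral representation (DLMF 10.32.9); it converges only for
   0 < z, the only case used below. *)
Definition besselK {R : realType} (nu z : R) : R :=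
  \int[lebesgue_measure]_(t in `]0, +oo[) (expR (- (z * cosh t)) * cosh (nu * t)).

Definition gamma_gamma_pdf {R : realType} (alpha beta x : R) : R :=
  if 0 < x then
    2 * (alpha * beta) `^ ((alpha + beta) / 2) /
      (Gamma_fun alpha * Gamma_fun beta) *
      x `^ ((alpha + beta) / 2 - 1) *
      besselK (alpha - beta) (2 * Num.sqrt (alpha * beta * x))
  else 0.

Definition is_gamma_gamma {d : measure_display} {T : measurableType d}
    {R : realType} (P : probability T R) (I : {RV P >-> R})
    (alpha beta : R) : Prop :=
  forall A : set R, measurable A ->
    distribution P I A =
    (\int[lebesgue_measure]_(x in A) (gamma_gamma_pdf alpha beta x)%:E)%E.

(* (X - mu) / sigma, with mu and sigma the mean and standard deviation of X *)
Definition standardized {d : measure_display} {T : measurableType d}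
    {R : realType} (P : probability T R) (X : T -> R) : T -> R :=
  fun w => (X w - fine 'E_P[X]) / Num.sqrt (fine 'V_P[X]).

(* The next two are kept in \bar R, so that a bound on them by a real number
   also asserts that they are finite. *)
Definition skewness {d : measure_display} {T : measurableType d}
    {R : realType} (P : probability T R) (X : T -> R) : \bar R :=
  'E_P[fun w => (standardized P X w ^+ 3)%R].

Definition excess_kurtosis {d : measure_display} {T : measurableType d}
    {R : realType} (P : probability T R) (X : T -> R) : \bar R :=
  ('E_P[fun w => (standardized P X w ^+ 4)%R] - 3%:E)%E.

(* Main.v *)
Require Import Defs.
From HB Require Import structures.
From mathcomp Require Import all_boot all_order all_algebra.
From mathcomp Require Import all_classical all_reals all_analysis.
From mathcomp Require Import measurable_realfun.
From mathcomp Require Import ring lra.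
Set Implicit Arguments.
Unset Strict Implicit.
Unset Printing Implicit Defensive.
Import Order.TTheory GRing.Theory Num.Theory.
Import numFieldNormedType.Exports.
Local Open Scope classical_set_scope.
Local Open Scope ring_scope.

(** The skewness and the excess kurtosis are explicit functions of the moments
    m_k = E[I^k] for k <= 4.  Once m_k is known to be the product over i < k of
    (1 + i a) (1 + i b), with a = 1 / alpha and b = 1 / beta, they are algebraic
    in a and b, and the claim is an elementary estimate on 0 < a <= b <= 1.

    The moments come from a recurrence, and neither a Gamma function nor a Bessel
    function is ever evaluated.  Put nu = alpha - beta, r = sqrt (alpha beta), and
    let M(s, j) be the double integral over x, t > 0 of

      x^(s-1) exp(- 2 r sqrt x cosh t) (cosh t)^j cosh(nu t).

    Inserting the integral that defines K_nu into the density gives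
    m_k = c M((alpha + beta) / 2 + k, 0), where c is the normalising constant.
    After exchanging the integrals, an integration by parts in x gives

      s M(s, j) = r M(s + 1/2, j + 1)                ([bessel_mellin_byparts]),

    and an integration by parts in t, that is, the modified Bessel equation at
    z = 2 r sqrt x, gives

      4 r^2 M(s + 1, 2) = 4 r^2 M(s + 1, 0) + 2 r M(s + 1/2, 1) + nu^2 M(s, 0)
                                                     ([bessel_mellin_ode]).

    Eliminating the terms with j > 0 leaves
    4 r^2 M(s + 1, 0) = (4 s^2 - nu^2) M(s, 0)       ([bessel_mellin_rec]),
    and at s = (alpha + beta) / 2 + k this reads
    m_(k+1) = (alpha + k) (beta + k) / (alpha beta) m_k.  The recurrence starts
    from m_0 = 1: the law of I has total mass one, which shows at the same time
    that c > 0 and that M is finite.  All integrands are nonnegative, so both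
    identities hold in [0, +oo] before any finiteness is known.

    With w = a + b the variance is w + a b, the third central moment is
    2 (a^2 + 3 a b + b^2) + O(a b w), and the fourth is
    3 (w + a b)^2 + 6 w (a^2 + 5 a b + b^2) + O(a b w^2).  Replacing the variance
    by w costs a relative error O(a b / w), and the leading terms so obtained are
    those of the statement written with tau = b / a ([skewness_estimate],
    [kurtosis_estimate]). *)

(** * Integration by parts on the half-line *)

(** Splitting the derivative of [F] into a positive and a negative part makes both
    sides meaningful in [0, +oo]: the identity is obtained on [0, n] from the
    fundamental theorem of calculus, and passes to the limit by monotone
    convergence, infinite values included. *)
Lemma ge0_FTC2y_balance (R : realType) (f g F : R -> R) :
  (forall x : R, 0 <= x -> 0 <= f x) -> (forall x : R, 0 <= x -> 0 <= g x) ->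
  {within `[0, +oo[, continuous f} -> {within `[0, +oo[, continuous g} ->
  F 0 = 0 -> F x @[x --> 0^'+] --> F 0 -> F x @[x --> +oo] --> (0 : R) ->
  (forall x : R, 0 < x -> is_derive x 1 F (f x - g x)) ->
  (\int[lebesgue_measure]_(x in `]0%R, +oo[) (f x)%:E =
   \int[lebesgue_measure]_(x in `]0%R, +oo[) (g x)%:E)%E.
Proof.
move=> f0 g0 cf cg F0 F0c Foo dF.
have mc (h : R -> R) : {within `[0, +oo[, continuous h} ->
    measurable_fun `](0:R), +oo[ (fun x => (h x)%:E).
  move=> /continuous_within_itvcyP[/in_continuous_mksetP ch _].
  by apply/measurable_EFinP; apply: open_continuous_measurable_fun.
have mcc (h : R -> R) : {within `[0, +oo[, continuous h} ->
    measurable_fun `[(0:R), +oo[ (fun x => (h x)%:E).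
  move=> /mc/measurable_EFinP mh; apply/measurable_EFinP.
  by apply/measurable_fun_itv_obnd_cbndP.
have itvE : `[0:R, +oo[%classic = \bigcup_n `[0%R, n.+1%:R]%classic.
  apply/seteqP; split => x /=; rewrite in_itv/= ?andbT => x0.
    exists (Num.truncn x) => //=.
    by rewrite in_itv/= x0 ltW// Num.Theory.truncnS_gt.
  by case: x0 => n _ /=; rewrite in_itv/= => /andP[].
have cvgI (h : R -> R) : {within `[0, +oo[, continuous h} ->
    (forall x, 0 <= x -> 0 <= h x) ->
  (\int[lebesgue_measure]_(x in `[0%R, n.+1%:R]) (h x)%:E)%E @[n --> \oo] -->
  (\int[lebesgue_measure]_(x in `]0%R, +oo[) (h x)%:E)%E.
  move=> ch h0; rewrite integral_itv_obnd_cbnd; last exact: mc.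
  rewrite itvE; apply: ge0_nondecreasing_set_cvg_integral => //.
  - move=> m n mn; apply/subsetPset; apply: subset_itvl.
    by rewrite bnd_simp ler_nat ltnS.
  - move=> n; apply: measurable_funS (mcc _ ch) => //; exact: subset_itvl.
  - by move=> n x /=; rewrite in_itv/= => /andP[x0 _]; rewrite lee_fin h0.
have IE n : (\int[lebesgue_measure]_(x in `[0%R, n.+1%:R]) (f x)%:E =
   \int[lebesgue_measure]_(x in `[0%R, n.+1%:R]) (g x)%:E + (F n.+1%:R)%:E)%E.
  have cn (h : R -> R) : {within `[0, +oo[, continuous h} -> {within `[0, n.+1%:R], continuous h}.
    by apply: continuous_subspaceW; exact: subset_itvl.
  have int (h : R -> R) : {within `[0, +oo[, continuous h} ->
      lebesgue_measure.-integrable (`[0, n.+1%:R]) (EFin \o h).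
    move=> ch; apply: continuous_compact_integrable; last exact: cn.
    exact: segment_compact.
  have := @continuous_FTC2 R (f \- g) F 0 n.+1%:R.
  rewrite F0 sube0 => <-; first last.
  - by move=> x; rewrite in_itv/= => /andP[x0 _]; rewrite derive1E; have [_ ->] := dF _ x0.
  - split.
    + by move=> x; rewrite in_itv/= => /andP[x0 _]; have [] := dF _ x0.
    + exact: F0c.
    + apply: cvg_at_left_filter.
      apply: differentiable_continuous; apply/derivable1_diffP.
      by have [] := dF n.+1%:R (ltr0Sn _ _).
  - move=> x; apply: cvgB; [exact: cn|exact: cn].
  - by rewrite ltr0n.
  rewrite integralB_EFin //; [|exact: int|exact: int].
  by rewrite addeC subeK// integrable_fin_num//; exact: int.
suff cvgF : (\int[lebesgue_measure]_(x in `[0%R, n.+1%:R]) (f x)%:E)%E @[n --> \oo]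
    --> (\int[lebesgue_measure]_(x in `]0%R, +oo[) (g x)%:E)%E.
  exact: (cvg_unique (@ereal_hausdorff R) (cvgI _ cf f0) cvgF).
rewrite (_ : (fun n => _) = (fun n =>
  (\int[lebesgue_measure]_(x in `[0%R, n.+1%:R]) (g x)%:E
   + (F n.+1%:R)%:E)%E)); last exact/funext.
rewrite -[X in _ --> X]adde0.
apply: cvgeD; [by rewrite fin_num_adde_defl| exact: cvgI|].
apply: cvg_EFin; first exact: nearW.
apply: ((cvg_pinftyP F 0).1 Foo).
apply/cvgryPge => r.
near=> n; apply: (@le_trans _ _ n%:R); last by rewrite ler_nat.
by near: n; exact: nbhs_infty_ger.
Unshelve. all: by end_near. Qed.

Lemma measurable_derivable (R : realType) (h : R -> R) :
  (forall t, derivable h t 1) -> measurable_fun setT h.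
Proof.
move=> dh; apply: continuous_measurable_fun => t.
by apply: differentiable_continuous; exact/derivable1_diffP.
Qed.

(** With N >= s, one term of order 2 N + 2 of the exponential series beats the
    power x^N = (sqrt x)^(2 N) and leaves a bound in 1 / x. *)
Lemma cvgry_powR_expR_sqrt (R : realType) (s a : R) : 0 < a ->
  x `^ s * expR (- (2 * a * Num.sqrt x)) @[x --> +oo] --> (0 : R).
Proof.
move=> a0.
pose N := (Num.truncn s).+1; pose K : R := (2 * N).+2`!%:R / (2 * a) ^+ (2 * N).+2.
have sN : s <= N%:R.
  have [s0|/ltW s0] := leP 0 s; last exact: le_trans s0 _.
  exact/ltW/Num.Theory.truncnS_gt.
have bnd : \forall x \near +oo, 0 <= x `^ s * expR (- (2 * a * Num.sqrt x)) <= K * x^-1.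
  near=> x.
  have x1 : 1 <= x by near: x; exact: nbhs_pinfty_ge.
  have x0 : 0 < x by exact: lt_le_trans x1.
  rewrite mulr_ge0 ?powR_ge0 ?expR_ge0//=.
  have u0 : 0 < Num.sqrt x by rewrite sqrtr_gt0.
  have xu : x = Num.sqrt x ^+ 2 by rewrite sqr_sqrtr// ltW.
  apply: (@le_trans _ _ (x ^+ N * expR (- (2 * a * Num.sqrt x)))).
    by rewrite ler_wpM2r ?expR_ge0// -powR_mulrn ?(ltW x0)//; exact: ler_powR.
  rewrite expRN ler_pdivrMr ?expR_gt0//.
  have M0 : 0 <= 2 * a * Num.sqrt x by rewrite !mulr_ge0// ltW.
  have /(le_trans _) := expR_ge1Dxn (2 * N).+1 M0.
  move=> /(_ ((2 * a * Num.sqrt x) ^+ (2 * N).+2 / (2 * N).+2`!%:R)) h.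
  have := h _; rewrite lerDr ler01 => /(_ isT) => {}h.
  apply: (@le_trans _ _ (K / x * ((2 * a * Num.sqrt x) ^+ (2 * N).+2 / (2 * N).+2`!%:R))); last first.
    by rewrite ler_wpM2l// !mulr_ge0 ?invr_ge0 ?(ltW x0)// exprn_ge0// mulr_ge0// ltW.
  rewrite le_eqVlt; apply/orP; left; apply/eqP.
  have -> : (2 * a * Num.sqrt x) ^+ (2 * N).+2 = (2 * a) ^+ (2 * N).+2 * (x ^+ N * x).
    rewrite exprMn; congr (_ * _).
    by rewrite -exprSr {2}xu -exprM mulnS add2n.
  have f0 : (2 * N).+2`!%:R != 0 :> R by rewrite pnatr_eq0 -lt0n fact_gt0.
  have p0 : (2 * a) ^+ (2 * N).+2 != 0 by rewrite expf_neq0// mulf_neq0 ?gt_eqF.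
  have x'0 : x != 0 by rewrite gt_eqF.
  rewrite /K.
  move: f0 p0; move: (_`!%:R) ((2 * a) ^+ _) (x ^+ N) => f p y f0 p0.
  by field; rewrite f0 p0 x'0.
apply: (squeeze_cvgr bnd); first exact: cvg_cst.
rewrite -[X in _ --> X](mulr0 K); apply: cvgMl_tmp.
by apply/(gtr0_cvgV0 _).2; [exact: nbhs_pinfty_gt|exact: cvg_id].
Unshelve. all: by end_near. Qed.

Lemma continuous_powR_expR_sqrt (R : realType) (s a : R) : 0 < s ->
  {within `[0, +oo[, continuous (fun x => x `^ s * expR (- (2 * a * Num.sqrt x)))}.
Proof.
move=> s0; apply/continuous_within_itvcyP; split.
  move=> x; rewrite in_itv/= andbT => x0.
  apply: differentiable_continuous; apply/derivable1_diffP.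
  have := is_derive1_powR s x0; have := is_derive1_sqrt x0 => ? ?.
  exact: ex_derive.
rewrite powR0 ?gt_eqF// mul0r -[X in _ --> X](mul0r (expR (- (2 * a * Num.sqrt 0)))).
apply: cvgM; first exact: powR_cvg0.
apply: cvg_at_right_filter.
apply: continuous_comp; last exact: continuous_expR.
apply: continuousN; apply: continuousM; [exact: cst_continuous|exact: sqrt_continuous].
Qed.

Lemma measurable_powR_expR_sqrt (R : realType) (s a : R) :
  measurable_fun [set: R] (fun x => x `^ s * expR (- (2 * a * Num.sqrt x))).
Proof.
apply: measurable_funM; first exact: measurable_powR.
apply: measurableT_comp => //; apply: measurableT_comp => //.
apply: measurable_funM => //.
by apply: continuous_measurable_fun; exact: sqrt_continuous.
Qed.

(** Integration by parts in x, with primitive x^s exp(- 2 a sqrt x).  The condition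
    1 < s makes the integrands continuous at 0. *)
Lemma integral_powR_expR_sqrt_byparts (R : realType) (s a : R) : 1 < s -> 0 < a ->
  (\int[lebesgue_measure]_(x in `]0%R, +oo[)
     (s * (x `^ (s - 1) * expR (- (2 * a * Num.sqrt x))))%:E =
   \int[lebesgue_measure]_(x in `]0%R, +oo[)
     (a * (x `^ (s + 2^-1 - 1) * expR (- (2 * a * Num.sqrt x))))%:E)%E.
Proof.
move=> s1 a0; have s0 : 0 < s by lra.
apply: (@ge0_FTC2y_balance _ _ _ (fun x => x `^ s * expR (- (2 * a * Num.sqrt x)))).
- by move=> x _; rewrite !mulr_ge0 ?powR_ge0 ?expR_ge0 ?ltW.
- by move=> x _; rewrite !mulr_ge0 ?powR_ge0 ?expR_ge0 ?ltW.
- move=> x; apply: cvgMl_tmp; move: x.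
  by apply: continuous_powR_expR_sqrt; lra.
- move=> x; apply: cvgMl_tmp; move: x.
  by apply: continuous_powR_expR_sqrt; lra.
- by rewrite powR0 ?gt_eqF// mul0r.
- by have /continuous_within_itvcyP[] := @continuous_powR_expR_sqrt _ s a s0.
- exact: cvgry_powR_expR_sqrt.
move=> x x0.
have := is_derive1_powR s x0; have := is_derive1_sqrt x0 => ? ?.
apply: is_derive_eq.
have u0 : Num.sqrt x != 0 by rewrite sqrtr_eq0 -ltNge.
have xE : x = Num.sqrt x ^+ 2 by rewrite sqr_sqrtr// ltW.
have -> : x `^ s = x `^ (s - 1) * Num.sqrt x ^+ 2.
  by rewrite -xE mulrC mulr_powRB1// ltW.
have -> : x `^ (s + 2^-1 - 1) = x `^ (s - 1) * Num.sqrt x.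
  rewrite addrAC -[Num.sqrt x]powR12_sqrt ?(ltW x0)// -powRD//.
  by rewrite (gt_eqF x0) implybT.
rewrite /GRing.scale/=.
move: u0; move: (Num.sqrt x) (x `^ (s - 1)) => u p u0.
by field.
Qed.

(** * Hyperbolic functions and the modified Bessel equation *)

Definition sinh {R : realType} (t : R) : R := (expR t - expR (- t)) / 2.

Lemma is_derive_cosh (R : realType) (t : R) : is_derive t 1 cosh (sinh t).
Proof.
rewrite /cosh; apply: is_derive_eq.
by rewrite /GRing.scale/= /sinh; ring.
Qed.

Lemma is_derive_sinh (R : realType) (t : R) : is_derive t 1 sinh (cosh t).
Proof.
rewrite /sinh; apply: is_derive_eq.
by rewrite /GRing.scale/= /cosh; ring.
Qed.

Lemma cosh_ge1 (R : realType) (t : R) : 1 <= cosh t.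
Proof.
rewrite /cosh expRN.
have e0 := expR_gt0 t; move: e0; move: (expR t) => e e0.
rewrite ler_pdivlMr// -(ler_pM2r e0) mulrDl mulVf ?gt_eqF//.
have := sqr_ge0 (e - 1); nra.
Qed.

Lemma cosh_ge0 (R : realType) (t : R) : 0 <= cosh t.
Proof. exact: le_trans (cosh_ge1 _). Qed.

Lemma measurable_cosh (R : realType) : measurable_fun setT (@cosh R).
Proof.
by apply: measurable_derivable => t; have ? := is_derive_cosh t; exact: ex_derive.
Qed.

Lemma sinh_sqr (R : realType) (t : R) : sinh t ^+ 2 = cosh t ^+ 2 - 1.
Proof.
rewrite /cosh /sinh expRN.
have e0 := expR_gt0 t; move: e0; move: (expR t) => e e0.
have : e != 0 by rewrite gt_eqF.
move=> ?; by field.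
Qed.

(** As cosh t >= t^2 / 8, the factor exp(- z cosh t) absorbs every exponential
    in t; this controls all integrals in t at infinity. *)
Lemma expR_cosh_bound (R : realType) (z k t : R) : 0 < z -> 0 <= k -> 0 <= t ->
  expR (- (z * cosh t)) * expR (k * t) <= expR (2 * (k + 1) ^+ 2 / z) * expR (- t).
Proof.
move=> z0 k0 t0.
rewrite -!expRD ler_expR.
have ct : t ^+ 2 / 8 <= cosh t.
  rewrite /cosh.
  have e2 : expR t = expR (t / 2) ^+ 2 by rewrite -expRM_natl; congr expR; lra.
  have h1 : 1 + t / 2 <= expR (t / 2) := expR_ge1Dx _.
  have h2 := expR_ge0 (- t).
  have : (1 + t / 2) ^+ 2 <= expR t by rewrite e2 lerXn2r// nnegrE ?expR_ge0// addr_ge0// divr_ge0.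
  have := sqr_ge0 t; nra.
have zt : z * (t ^+ 2 / 8) <= z * cosh t by rewrite ler_pM2l.
suff : k * t + t <= 2 * (k + 1) ^+ 2 / z + z * (t ^+ 2 / 8) by lra.
rewrite -(ler_pM2r z0) [leRHS]mulrDl divfK ?gt_eqF//.
(* AM-GM: the bound is the maximum over t of (k + 1) t - z t^2 / 8 *)
have := sqr_ge0 (z * t - 4 * (k + 1)); nra.
Qed.

Lemma cosh_le_expR (R : realType) (x t : R) : 0 <= t -> cosh (x * t) <= expR (`|x| * t).
Proof.
move=> t0; rewrite /cosh ler_pdivrMr// mulr_natr mulr2n lerD// ler_expR.
  by rewrite ler_wpM2r// ler_norm.
by rewrite -mulNr ler_wpM2r// -normrN ler_norm.
Qed.

Lemma norm_sinh_le_cosh (R : realType) (t : R) : `|sinh t| <= cosh t.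
Proof.
rewrite /sinh /cosh normrM [`|2^-1|]ger0_norm// ler_wpM2r//.
rewrite (le_trans (ler_normB _ _))// !ger0_norm ?expR_ge0//.
Qed.

(** This is the modified Bessel equation z^2 K'' + z K' = (z^2 + nu^2) K for
    K(z), the integral of exp(- z cosh t) cosh(nu t): each derivative in z brings
    down a factor - cosh t.  The terms are arranged so that both integrands are
    nonnegative, and the difference of the two integrands is an exact derivative
    in t, so that no differentiation under the integral sign is needed. *)
Lemma bessel_ode_integral (R : realType) (nu z : R) : 0 < z ->
  (\int[lebesgue_measure]_(t in `]0%R, +oo[)
     ((z ^+ 2 + z * cosh t + nu ^+ 2) *
      (expR (- (z * cosh t)) * cosh (nu * t)))%:E =
   \int[lebesgue_measure]_(t in `]0%R, +oo[)
     (z ^+ 2 * cosh t ^+ 2 * (expR (- (z * cosh t)) * cosh (nu * t)))%:E)%E.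
Proof.
move=> z0.
have c0 := @cosh_ge0 R.
have dc (t : R) := is_derive_cosh t.
have ds (t : R) := is_derive_sinh t.
pose F (t : R) := expR (- (z * cosh t)) * (z * sinh t * cosh (nu * t) + nu * sinh (nu * t)).
have dF (t : R) : is_derive t 1 F ((z ^+ 2 + z * cosh t + nu ^+ 2) *
      (expR (- (z * cosh t)) * cosh (nu * t)) -
      z ^+ 2 * cosh t ^+ 2 * (expR (- (z * cosh t)) * cosh (nu * t))).
  rewrite /F; apply: is_derive_eq.
  rewrite /GRing.scale/=.
  by rewrite -[cosh t ^+ 2](subrK 1) -sinh_sqr; ring.
have cont (h : R -> R) : (forall t, derivable h t 1) -> {within `[0, +oo[, continuous h}.
  move=> dh; apply: continuous_subspaceT => t.
  by apply: differentiable_continuous; apply/derivable1_diffP.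
apply: (@ge0_FTC2y_balance _ _ _ F).
- move=> t _; rewrite !mulr_ge0 ?expR_ge0 ?c0//.
  have := mulr_ge0 (ltW z0) (c0 t); have := sqr_ge0 z; have := sqr_ge0 nu; lra.
- by move=> t _; rewrite mulr_ge0 ?mulr_ge0 ?expR_ge0 ?sqr_ge0 ?c0 //= ltW.
- by apply: cont => t; exact: ex_derive.
- by apply: cont => t; exact: ex_derive.
- by rewrite /F /sinh !mulr0 oppr0 expR0 subrr mul0r !mulr0 mul0r addr0 mulr0.
- apply: cvg_at_right_filter.
  apply: differentiable_continuous; apply/derivable1_diffP.
  by have [] := dF 0.
- pose K := (z + `|nu|) * expR (2 * ((1 + `|nu|) + 1) ^+ 2 / z).
  apply: norm_cvg0.
  have bnd : \forall t \near +oo, 0 <= `|F t| <= K * expR (- t).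
    near=> t; have t0 : 0 <= t by near: t; exact: nbhs_pinfty_ge.
    rewrite normr_ge0/= /K -mulrA.
    apply: le_trans (ler_wpM2l _ (expR_cosh_bound z0 _ t0)); [|by rewrite addr_ge0// ltW|by rewrite addr_ge0].
    rewrite /F normrM ger0_norm ?expR_ge0// [leRHS]mulrCA ler_wpM2l ?expR_ge0//.
    have shn : `|sinh (nu * t)| <= expR (`|nu| * t).
      exact: le_trans (norm_sinh_le_cosh _) (cosh_le_expR _ t0).
    have e1 : expR (`|nu| * t) <= expR ((1 + `|nu|) * t).
      by rewrite ler_expR ler_wpM2r// lerDr.
    rewrite (le_trans (ler_normD _ _))// mulrDl lerD//.
      rewrite -mulrA normrM gtr0_norm// ler_wpM2l ?(ltW z0)// normrM.
      rewrite mulrDl mul1r expRD ler_pM//.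
        rewrite (le_trans (norm_sinh_le_cosh _))//.
        by have := cosh_le_expR 1 t0; rewrite normr1 !mul1r.
      by rewrite ger0_norm ?c0// cosh_le_expR.
    by rewrite normrM ler_wpM2l// (le_trans shn).
  apply: (squeeze_cvgr bnd); first exact: cvg_cst.
  rewrite -[X in _ --> X](mulr0 K); apply: cvgMl_tmp.
  exact: cvgr_expR.
Unshelve. all: by end_near. Qed.

Lemma integral_expRN_lty (R : realType) :
  (\int[lebesgue_measure]_(t in `]0%R, +oo[) (expR (- t))%:E < +oo :> \bar R)%E.
Proof.
have dF (x : R) : is_derive x 1 (fun x => - expR (- x)) (expR (- x)).
  by apply: is_derive_eq; rewrite /GRing.scale/= mulrN1 opprK.
have ce : continuous (fun x : R => expR (- x)).
  by move=> x; apply: continuous_comp; [exact: continuousN|exact: continuous_expR].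
rewrite integral_itv_obnd_cbnd; last first.
  apply/measurable_EFinP; apply: measurable_funTS.
  exact: continuous_measurable_fun.
rewrite (@ge0_continuous_FTC2y _ _ (fun x => - expR (- x)) _ (- 0)) ?ltry//.
- exact: continuous_subspaceT.
- by apply: cvgN; exact: cvgr_expR.
- by apply: cvgN; apply: cvg_at_right_filter; exact: ce.
- by move=> x _; rewrite derive1E; have [_ ->] := dF x.
Qed.

(** Finiteness matters because [besselK] is a real-valued integral, which would
    be 0 if the integral were infinite. *)
Lemma bessel_integral_lty (R : realType) (nu z : R) : 0 < z ->
  (\int[lebesgue_measure]_(t in `]0%R, +oo[)
     (expR (- (z * cosh t)) * cosh (nu * t))%:E < +oo)%E.
Proof.
move=> z0.
have mc := @measurable_cosh R.
pose K := expR (2 * (`|nu| + 1) ^+ 2 / z).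
apply: (@le_lt_trans _ _ (\int[lebesgue_measure]_(t in `]0%R, +oo[) (K%:E * (expR (- t))%:E)%E)%E).
  apply: ge0_le_integral => //=.
  - move=> t _; rewrite lee_fin mulr_ge0 ?expR_ge0//.
    exact: cosh_ge0.
  - apply/measurable_EFinP; apply: measurable_funTS; apply: measurable_funM => /=.
    + apply: measurableT_comp => //; apply: measurableT_comp => //.
      by apply: measurable_funM => //.
    + by apply: measurableT_comp => //; apply: measurable_funM => //.
  - apply/measurable_EFinP; apply: measurable_funTS; apply: measurable_funM => //=.
    by apply: measurableT_comp => //; apply: measurableT_comp.
  - move=> t; rewrite in_itv/= andbT => /ltW t0; rewrite -EFinM lee_fin.
    apply: le_trans (expR_cosh_bound z0 _ t0); last exact: normr_ge0.
    by rewrite ler_wpM2l ?expR_ge0// cosh_le_expR.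
rewrite ge0_integralZl//=.
- by rewrite lte_mul_pinfty ?integral_expRN_lty// lee_fin expR_ge0.
- apply/measurable_EFinP; apply: measurable_funTS => /=.
  by apply: measurableT_comp => //; apply: measurableT_comp.
- by rewrite lee_fin expR_ge0.
Qed.

(** * Iterated integrals of nonnegative functions over measurable sets *)

Section tonelli_on_sets.
Context d1 d2 (T1 : measurableType d1) (T2 : measurableType d2) (R : realType).
Variables (m1 : {sigma_finite_measure set T1 -> \bar R})
          (m2 : {sigma_finite_measure set T2 -> \bar R}).
Variables (D : set T1) (E : set T2) (f : T1 * T2 -> \bar R).
Hypotheses (mD : measurable D) (mE : measurable E).
Hypotheses (mf : measurable_fun [set: T1 * T2] f) (f0 : forall z, (0 <= f z)%E).
Local Open Scope ereal_scope.

Let g : T1 * T2 -> \bar R := f \_ (D `*` E).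

Let g0 z : 0 <= g z.
Proof. by rewrite /g patchE; case: ifP. Qed.

Let mg : measurable_fun setT g.
Proof.
apply/(measurable_restrictT f (measurableX mD mE)).
exact: measurable_funTS.
Qed.

Let intE x : \int[m2]_y g (x, y) = ((fun x => \int[m2]_(y in E) f (x, y)) \_ D) x.
Proof.
rewrite patchE; case: ifPn => xD.
  rewrite [RHS]integral_mkcond; apply: eq_integral => y _.
  by rewrite /g !patchE/= in_setX xD.
apply: integral0_eq => y _; rewrite /g patchE in_setX/= (negbTE xD)//.
Qed.

Let intD y : \int[m1]_x g (x, y) = ((fun y => \int[m1]_(x in D) f (x, y)) \_ E) y.
Proof.
rewrite patchE; case: ifPn => yE.
  rewrite [RHS]integral_mkcond; apply: eq_integral => x _.
  by rewrite /g !patchE/= in_setX yE andbT.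
apply: integral0_eq => x _; rewrite /g patchE in_setX/= (negbTE yE) andbF//.
Qed.

Lemma measurable_section_integral :
  measurable_fun D (fun x => \int[m2]_(y in E) f (x, y)).
Proof.
apply/(measurable_restrictT _ mD).
rewrite (_ : _ \_ D = fun x => \int[m2]_y g (x, y)); last first.
  by apply/funext => x; rewrite intE.
exact: (measurable_fun_fubini_tonelli_F (m2 := m2) _ mg g0).
Qed.

Lemma fubini_tonelli_in :
  \int[m1]_(x in D) \int[m2]_(y in E) f (x, y) =
  \int[m2]_(y in E) \int[m1]_(x in D) f (x, y).
Proof.
rewrite [LHS]integral_mkcond [RHS]integral_mkcond.
under eq_integral do rewrite -intE.
under [RHS]eq_integral do rewrite -intD.
exact: fubini_tonelli.
Qed.

End tonelli_on_sets.

(** * Mellin transform of the Bessel integral and its recurrence *)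

Definition bessel_mellin_kernel {R : realType} (nu r s : R) (j : nat) (x t : R) : R :=
  x `^ (s - 1) * (expR (- (2 * r * Num.sqrt x * cosh t)) * cosh (nu * t)) *
  cosh t ^+ j.

(** For j = 0 this is the Mellin transform at s of x |-> K_nu(2 r sqrt x); the
    power of cosh t accounts for the derivatives of K_nu, up to sign. *)
Definition bessel_mellin {R : realType} (nu r s : R) (j : nat) : \bar R :=
  (\int[lebesgue_measure]_(x in `]0%R, +oo[) \int[lebesgue_measure]_(t in `]0%R, +oo[)
     (bessel_mellin_kernel nu r s j x t)%:E)%E.

Lemma bessel_mellin_kernel_ge0 (R : realType) (nu r s : R) j x t : 0 <= bessel_mellin_kernel nu r s j x t.
Proof.
rewrite /bessel_mellin_kernel; apply: mulr_ge0; last by rewrite exprn_ge0 ?cosh_ge0.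
by apply: mulr_ge0; [exact: powR_ge0|apply: mulr_ge0; [exact: expR_ge0|exact: cosh_ge0]].
Qed.

Lemma measurable_bessel_mellin_kernel (R : realType) (nu r s : R) j :
  measurable_fun [set: R * R] (fun z => (bessel_mellin_kernel nu r s j z.1 z.2)%:E).
Proof.
apply/measurable_EFinP; rewrite /bessel_mellin_kernel.
have m2 (h : R -> R) : measurable_fun setT h -> measurable_fun [set: R * R] (fun z => h z.2).
  by move=> mh; apply: measurableT_comp => //.
have m1 (h : R -> R) : measurable_fun setT h -> measurable_fun [set: R * R] (fun z => h z.1).
  by move=> mh; apply: measurableT_comp => //.
apply: measurable_funM; last first.
  by apply: measurable_funX; apply: m2; exact: measurable_cosh.
apply: measurable_funM; first by apply: (m1 (fun x => x `^ (s - 1))); exact: measurable_powR.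
apply: measurable_funM; last first.
  apply: (m2 (fun t => cosh (nu * t))); apply: measurableT_comp; first exact: measurable_cosh.
  exact: measurable_funM.
apply: measurableT_comp => //; apply: measurableT_comp => //.
apply: measurable_funM; last by apply: m2; exact: measurable_cosh.
apply: (m1 (fun x => 2 * r * Num.sqrt x)); apply: measurable_funM => //.
by apply: continuous_measurable_fun; exact: sqrt_continuous.
Qed.

Lemma measurable_bessel_mellin_kernel_t (R : realType) (nu r s : R) j x :
  measurable_fun [set: R] (fun t => bessel_mellin_kernel nu r s j x t).
Proof.
apply/measurable_EFinP.
exact: (measurable_fun_pair2 x (measurable_bessel_mellin_kernel nu r s j)).
Qed.

Lemma measurable_bessel_mellin_section (R : realType) (nu r s : R) j :
  measurable_fun (`](0 : R), +oo[) (fun x =>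
    \int[lebesgue_measure]_(t in `]0%R, +oo[) (bessel_mellin_kernel nu r s j x t)%:E)%E.
Proof.
apply: (@measurable_section_integral _ _ _ _ R lebesgue_measure
  _ _ (fun z => (bessel_mellin_kernel nu r s j z.1 z.2)%:E)) => //.
  exact: measurable_bessel_mellin_kernel.
by move=> z; rewrite lee_fin bessel_mellin_kernel_ge0.
Qed.

Lemma bessel_mellinZl (R : realType) (nu r s c : R) j : 0 <= c ->
  (c%:E * bessel_mellin nu r s j = \int[lebesgue_measure]_(x in `]0%R, +oo[)
    \int[lebesgue_measure]_(t in `]0%R, +oo[) (c * bessel_mellin_kernel nu r s j x t)%:E)%E.
Proof.
move=> c0; have k0 := bessel_mellin_kernel_ge0 nu r s j.
rewrite /bessel_mellin -ge0_integralZl//=; last 2 first.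
- exact: measurable_bessel_mellin_section.
- by move=> x _; apply: integral_ge0 => t _; rewrite lee_fin.
apply: eq_integral => x _; rewrite -ge0_integralZl//=.
apply/measurable_EFinP/measurable_funTS; exact: measurable_bessel_mellin_kernel_t.
by move=> t _; rewrite lee_fin.
Qed.

Lemma bessel_mellinZl_swap (R : realType) (nu r s c : R) j : 0 <= c ->
  (c%:E * bessel_mellin nu r s j = \int[lebesgue_measure]_(t in `]0%R, +oo[)
    \int[lebesgue_measure]_(x in `]0%R, +oo[) (c * bessel_mellin_kernel nu r s j x t)%:E)%E.
Proof.
move=> c0; have k0 := bessel_mellin_kernel_ge0 nu r s j.
rewrite (bessel_mellinZl _ _ _ _ c0).
apply: (@fubini_tonelli_in _ _ _ _ R lebesgue_measure lebesgue_measure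
  _ _ (fun z => (c * bessel_mellin_kernel nu r s j z.1 z.2)%:E)) => //.
  apply/measurable_EFinP; apply: measurable_funM => //.
  by apply/measurable_EFinP; exact: measurable_bessel_mellin_kernel.
by move=> z; rewrite lee_fin mulr_ge0.
Qed.

(** For fixed t this is the integration by parts in x with a = r cosh t; the
    factor cosh t of a is what raises j. *)
Lemma bessel_mellin_byparts (R : realType) (nu r s : R) j : 1 < s -> 0 < r ->
  (s%:E * bessel_mellin nu r s j = r%:E * bessel_mellin nu r (s + 2^-1) j.+1)%E.
Proof.
move=> s1 r0; have s0 : 0 < s by lra.
rewrite (bessel_mellinZl_swap _ _ _ _ (ltW s0)) (bessel_mellinZl_swap _ _ _ _ (ltW r0)); apply: eq_integral => t _.
have c0 : 0 < cosh t :> R by rewrite (lt_le_trans _ (cosh_ge1 t)).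
have k0 : 0 <= cosh (nu * t) * cosh t ^+ j by rewrite mulr_ge0 ?exprn_ge0 ?cosh_ge0.
have eE x : 2 * (r * cosh t) * Num.sqrt x = 2 * r * Num.sqrt x * cosh t by ring.
pose K := (cosh (nu * t) * cosh t ^+ j)%R.
pose f u b (x : R) := (b * (x `^ u * expR (- (2 * (r * cosh t) * Num.sqrt x))))%:E.
have fK u b : 0 <= b -> (\int[lebesgue_measure]_(x in `]0%R, +oo[) (K%:E * f u b x) =
    K%:E * \int[lebesgue_measure]_(x in `]0%R, +oo[) f u b x)%E.
  move=> b0; apply: ge0_integralZl => //.
  - apply/measurable_EFinP; apply: measurable_funTS; apply: measurable_funM => //.
    exact: measurable_powR_expR_sqrt.
  - by move=> x _; rewrite lee_fin !mulr_ge0 ?powR_ge0 ?expR_ge0.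
transitivity (\int[lebesgue_measure]_(x in `]0%R, +oo[) (K%:E * f (s - 1)%R s x))%E.
  by apply: eq_integral => x _; rewrite -EFinM /K eE /bessel_mellin_kernel; congr (_%:E); ring.
transitivity (\int[lebesgue_measure]_(x in `]0%R, +oo[) (K%:E * f (s + 2^-1 - 1)%R (r * cosh t)%R x))%E; last first.
  by apply: eq_integral => x _; rewrite -EFinM /K eE /bessel_mellin_kernel exprS; congr (_%:E); ring.
rewrite (fK _ _ (ltW s0)) (fK _ _ (ltW (mulr_gt0 r0 c0))); congr (mule _ _).
exact: integral_powR_expR_sqrt_byparts s1 (mulr_gt0 r0 c0).
Qed.

Lemma iterated_integralD d1 d2 (T1 : measurableType d1) (T2 : measurableType d2)
    (R : realType) (m1 : {sigma_finite_measure set T1 -> \bar R})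
    (m2 : {sigma_finite_measure set T2 -> \bar R}) (D : set T1) (E : set T2)
    (f g : T1 * T2 -> \bar R) :
  measurable D -> measurable E ->
  measurable_fun [set: T1 * T2] f -> (forall z, 0 <= f z)%E ->
  measurable_fun [set: T1 * T2] g -> (forall z, 0 <= g z)%E ->
  (\int[m1]_(x in D) \int[m2]_(y in E) (f (x, y) + g (x, y)) =
   \int[m1]_(x in D) \int[m2]_(y in E) f (x, y) +
   \int[m1]_(x in D) \int[m2]_(y in E) g (x, y))%E.
Proof.
move=> mD mE mf f0 mg g0.
rewrite -(@ge0_integralD _ _ _ m1 D mD (fun x => \int[m2]_(y in E) f (x, y))%E
  (fun x => \int[m2]_(y in E) g (x, y))%E).
- apply: eq_integral => x _; rewrite ge0_integralD//.
  + by apply: measurable_funTS; exact: measurable_fun_pair2.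
  + by apply: measurable_funTS; exact: measurable_fun_pair2.
- by move=> x _; exact: integral_ge0.
- exact: measurable_section_integral.
- by move=> x _; exact: integral_ge0.
- exact: measurable_section_integral.
Qed.

(** The Bessel equation at z = 2 r sqrt x, multiplied by x^(s-1): the factors z^2
    and z shift s by 1 and by 1/2. *)
Lemma bessel_mellin_kernel_ode (R : realType) (nu r s x : R) : 0 < r -> 0 < x ->
  (\int[lebesgue_measure]_(t in `]0%R, +oo[)
     (4 * r ^+ 2 * bessel_mellin_kernel nu r (s + 1) 2 x t)%:E =
   \int[lebesgue_measure]_(t in `]0%R, +oo[)
     (4 * r ^+ 2 * bessel_mellin_kernel nu r (s + 1) 0 x t +
      2 * r * bessel_mellin_kernel nu r (s + 2^-1) 1 x t +
      nu ^+ 2 * bessel_mellin_kernel nu r s 0 x t)%:E)%E.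
Proof.
move=> r0 x0.
have u0 : 0 < Num.sqrt x by rewrite sqrtr_gt0.
have z0 : 0 < 2 * r * Num.sqrt x by rewrite !mulr_gt0.
have xE : x = Num.sqrt x ^+ 2 by rewrite sqr_sqrtr// ltW.
have x1E : x `^ (s + 1 - 1) = x `^ (s - 1) * Num.sqrt x ^+ 2.
  have -> : s + 1 - 1 = s - 1 + 1 by ring.
  rewrite -xE -{3}[x](powRr1 (ltW x0)) -powRD//.
  by rewrite (gt_eqF x0) implybT.
have x2E : x `^ (s + 2^-1 - 1) = x `^ (s - 1) * Num.sqrt x.
  rewrite addrAC -[Num.sqrt x]powR12_sqrt ?(ltW x0)// -powRD//.
  by rewrite (gt_eqF x0) implybT.
have dc (t : R) := is_derive_cosh t.
have q0 := powR_ge0 x (s - 1).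
have := bessel_ode_integral nu z0.
move=> /(congr1 (fun y => (x `^ (s - 1))%:E * y)%E).
set z := 2 * r * Num.sqrt x.
have c0 (t : R) := cosh_ge0 t.
have ez (t : R) : 0 <= expR (- (z * cosh t)) * cosh (nu * t).
  by apply: mulr_ge0; [exact: expR_ge0|exact: cosh_ge0].
rewrite -ge0_integralZl; [|by []| | |by []].
- rewrite -ge0_integralZl; [|by []| | |by []].
  + move=> h; symmetry; etransitivity; last (etransitivity; first exact: h).
    * apply: eq_integral => t _; rewrite -EFinM /bessel_mellin_kernel x1E x2E -/z.
      by rewrite /z; congr (_%:E); ring.
    * apply: eq_integral => t _; rewrite -EFinM /bessel_mellin_kernel x1E -/z.
      by rewrite /z; congr (_%:E); ring.
  + apply/measurable_EFinP/measurable_funTS; apply: measurable_derivable => t.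
    exact: ex_derive.
  + move=> t _; rewrite lee_fin mulr_ge0 ?ez// mulr_ge0 ?sqr_ge0//.
- apply/measurable_EFinP/measurable_funTS; apply: measurable_derivable => t.
  exact: ex_derive.
- move=> t _; rewrite lee_fin mulr_ge0 ?ez//.
  have := mulr_ge0 (ltW z0) (c0 t); have := sqr_ge0 z; have := sqr_ge0 nu; rewrite -/z; lra.
Qed.

Lemma bessel_mellin_ode (R : realType) (nu r s : R) : 0 < r ->
  ((4 * r ^+ 2)%:E * bessel_mellin nu r (s + 1) 2 =
   (4 * r ^+ 2)%:E * bessel_mellin nu r (s + 1) 0 + (2 * r)%:E * bessel_mellin nu r (s + 2^-1) 1
   + (nu ^+ 2)%:E * bessel_mellin nu r s 0)%E.
Proof.
move=> r0.
have r20 : 0 <= 4 * r ^+ 2 by rewrite mulr_ge0 ?sqr_ge0.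
have r10 : 0 <= 2 * r by rewrite mulr_ge0 ?ltW.
have n20 := sqr_ge0 nu.
pose k c s j (z : R * R) := (c * bessel_mellin_kernel nu r s j z.1 z.2)%:E.
have k0 c u j z : 0 <= c -> (0 <= k c u j z)%E.
  by move=> c0; rewrite lee_fin mulr_ge0 ?bessel_mellin_kernel_ge0.
have mk c u j : measurable_fun setT (k c u j).
  apply/measurable_EFinP; apply: measurable_funM => //.
  by apply/measurable_EFinP; exact: measurable_bessel_mellin_kernel.
pose k1 := k (4 * r ^+ 2) (s + 1) 0%N; pose k2 := k (2 * r) (s + 2^-1) 1%N; pose k3 := k (nu ^+ 2) s 0%N.
rewrite !bessel_mellinZl; [|exact: n20|exact: r10|exact: r20|exact: r20].
transitivity (\int[lebesgue_measure]_(x in `]0%R, +oo[)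
    \int[lebesgue_measure]_(t in `]0%R, +oo[) ((k1 (x, t) + k2 (x, t)) + k3 (x, t)))%E; last first.
  rewrite (@iterated_integralD _ _ _ _ _ lebesgue_measure lebesgue_measure _ _ (k1 \+ k2)%E k3).
    rewrite (@iterated_integralD _ _ _ _ _ lebesgue_measure lebesgue_measure _ _ k1 k2)//.
    + exact: mk.
    + by move=> z; exact: k0.
    + exact: mk.
    + by move=> z; exact: k0.
  + by [].
  + by [].
  + by apply: emeasurable_funD; exact: mk.
  + by move=> z; rewrite adde_ge0// k0.
  + exact: mk.
  + by move=> z; exact: k0.
apply: eq_integral => x; rewrite inE/= in_itv/= andbT => x0.
exact: bessel_mellin_kernel_ode.
Qed.

Lemma pmule_EFin_inj (R : realType) (r y : R) (X : \bar R) : 0 < r ->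
  (r%:E * X = y%:E -> X = (y / r)%:E)%E.
Proof.
move=> r0; case: X => [x| |].
- by move=> [<-]; rewrite mulrC mulKf ?gt_eqF.
- by rewrite gt0_muley ?lte_fin.
- by rewrite gt0_muleNy ?lte_fin.
Qed.

(** Two integrations by parts in x express M(s + 1/2, 1) and M(s + 1, 2) through
    M(s, 0), and the Bessel equation is then a linear equation in M(s + 1, 0). *)
Lemma bessel_mellin_rec (R : realType) (nu r s m : R) : 1 < s -> 0 < r ->
  bessel_mellin nu r s 0 = m%:E ->
  bessel_mellin nu r (s + 1) 0 = ((4 * s ^+ 2 - nu ^+ 2) / (4 * r ^+ 2) * m)%:E.
Proof.
move=> s1 r0 m0.
have h1 : bessel_mellin nu r (s + 2^-1) 1 = (s * m / r)%:E.
  by apply: (pmule_EFin_inj r0); rewrite -bessel_mellin_byparts// m0.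
have h2 : bessel_mellin nu r (s + 1) 2 = ((s + 2^-1) * (s * m / r) / r)%:E.
  apply: (pmule_EFin_inj r0).
  have -> : s + 1 = s + 2^-1 + 2^-1 by field.
  by rewrite -bessel_mellin_byparts ?h1//; lra.
have := bessel_mellin_ode nu s r0; rewrite h1 h2 m0.
have r20 : 0 < 4 * r ^+ 2 by rewrite mulr_gt0 ?exprn_gt0.
case: (bessel_mellin nu r (s + 1) 0) => [y| |]; last 2 first.
- by rewrite gt0_muley ?lte_fin//.
- by rewrite gt0_muleNy ?lte_fin//.
move=> [h]; congr (_%:E).
apply: (@mulfI _ (4 * r ^+ 2)); first by rewrite gt_eqF.
have r' : r != 0 by rewrite gt_eqF.
apply/eqP; rewrite -subr_eq0; apply/eqP.
move/eqP: h; rewrite eq_sym -subr_eq0 => /eqP h.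
by rewrite -[RHS]h; field.

Qed.

(** [p] agrees almost everywhere with the Radon-Nikodym derivative of [nu], for
    which the change of variables is known. *)
Lemma ge0_integral_density d (T : measurableType d) (R : realType)
    (nu : {finite_measure set T -> \bar R})
    (mu : {sigma_finite_measure set T -> \bar R}) (p f : T -> \bar R) :
  measurable_fun setT p ->
  (forall A, measurable A -> nu A = (\int[mu]_(x in A) p x)%E) ->
  measurable_fun setT f -> (forall x, 0 <= f x)%E ->
  (\int[nu]_x f x = \int[mu]_x (f x * p x))%E.
Proof.
move=> mp nuE mf f0.
have dom : nu `<< mu.
  apply/null_content_dominatesP => A mA muA0; rewrite nuE//.
  by apply: null_set_integral => //; exact: measurable_funTS.
rewrite -(Radon_Nikodym_SigmaFinite.change_of_variables dom)//.
have iRN := Radon_Nikodym_SigmaFinite.f_integrable dom.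
have mRN := measurable_int mu iRN.
apply: ae_eq_integral => //; [exact: emeasurable_funM|exact: emeasurable_funM|].
apply: ae_eqe_mul2l; apply: integral_ae_eq => //.
by move=> E _ mE; rewrite -nuE// (Radon_Nikodym_SigmaFinite.f_integral dom).
Qed.

(** * Moments of the Gamma-Gamma distribution *)

Section gamma_gamma_moments.
Context {R : realType} (alpha beta : R).
Hypotheses (alpha0 : 0 < alpha) (beta0 : 0 < beta).
Local Notation nu := (alpha - beta).
Local Notation s := ((alpha + beta) / 2).
Local Notation r := (Num.sqrt (alpha * beta)).

Definition gamma_gamma_norm : R :=
  2 * (alpha * beta) `^ s / (Gamma_fun alpha * Gamma_fun beta).

Lemma gamma_gamma_norm_ge0 : 0 <= gamma_gamma_norm.
Proof.
rewrite /gamma_gamma_norm divr_ge0//; first by rewrite mulr_ge0 ?powR_ge0.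
by rewrite mulr_ge0//; apply: Rintegral_ge0 => // t _; rewrite mulr_ge0 ?powR_ge0 ?expR_ge0.
Qed.

Lemma gamma_gamma_pdf_moment (k : nat) (x : R) : 0 < x ->
  ((x ^+ k * gamma_gamma_pdf alpha beta x)%:E = gamma_gamma_norm%:E *
   \int[lebesgue_measure]_(t in `]0%R, +oo[) (bessel_mellin_kernel nu r (s + k%:R) 0 x t)%:E)%E.
Proof.
move=> x0.
have r0 : 0 < r by rewrite sqrtr_gt0 mulr_gt0.
have z0 : 0 < 2 * (r * Num.sqrt x) by rewrite mulr_gt0// mulr_gt0// sqrtr_gt0.
have Klty := bessel_integral_lty nu z0.
have mK : measurable_fun (`](0 : R), +oo[)
    (fun t => (expR (- (2 * (r * Num.sqrt x) * cosh t)) * cosh (nu * t))%:E).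
  apply/measurable_EFinP/measurable_funTS; apply: measurable_derivable => t.
  have dc (u : R) := is_derive_cosh u; exact: ex_derive.
have K0 (t : R) : (0 <= (expR (- (2 * (r * Num.sqrt x) * cosh t)) * cosh (nu * t))%:E)%E.
  by rewrite lee_fin; apply: mulr_ge0; [exact: expR_ge0|exact: cosh_ge0].
rewrite /gamma_gamma_pdf x0 -/gamma_gamma_norm /besselK sqrtrM ?mulr_ge0 ?ltW//.
have -> : (\int[lebesgue_measure]_(t in `]0%R, +oo[) (bessel_mellin_kernel nu r (s + k%:R) 0 x t)%:E =
   (x ^+ k * x `^ (s - 1))%:E * \int[lebesgue_measure]_(t in `]0%R, +oo[)
   (expR (- (2 * (r * Num.sqrt x) * cosh t)) * cosh (nu * t))%:E)%E.
  rewrite -ge0_integralZl; [|by []|exact: mK|by move=> t _; exact: K0|by rewrite lee_fin mulr_ge0 ?exprn_ge0 ?powR_ge0// ltW].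
  apply: eq_integral => t _; rewrite -EFinM /bessel_mellin_kernel expr0 mulr1.
  congr (EFin (_ * _)); last by congr (expR _ * _); ring.
  rewrite -powR_mulrn ?(ltW x0)// -powRD; last by rewrite (gt_eqF x0) implybT.
  by congr (_ `^ _); ring.
rewrite /Rintegral; set K := (X in fine X).
have Kfin : K \is a fin_num by rewrite ge0_fin_numE// integral_ge0.
transitivity (gamma_gamma_norm%:E * ((x ^+ k * x `^ (s - 1))%:E * K))%E; last by [].
by rewrite -[in RHS](fineK Kfin) -!EFinM; congr EFin; ring.
Qed.

Lemma gamma_gamma_pdf_le0 (x : R) : x <= 0 -> gamma_gamma_pdf alpha beta x = 0.
Proof. by rewrite /gamma_gamma_pdf leNgt => /negbTE ->. Qed.

Lemma gamma_gamma_pdfE :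
  (fun x => (gamma_gamma_pdf alpha beta x)%:E) = (fun x => gamma_gamma_norm%:E *
   \int[lebesgue_measure]_(t in `]0%R, +oo[) (bessel_mellin_kernel nu r s 0 x t)%:E)%E \_ `]0, +oo[.
Proof.
apply/funext => x; rewrite patchE; case: ifPn => [|].
  rewrite inE/= in_itv/= andbT => x0.
  by have := gamma_gamma_pdf_moment 0 x0; rewrite expr0 mul1r addr0.
by rewrite notin_setE/= in_itv/= andbT => /negP; rewrite -leNgt => /gamma_gamma_pdf_le0 ->.
Qed.

Lemma measurable_gamma_gamma_pdf :
  measurable_fun setT (fun x => (gamma_gamma_pdf alpha beta x)%:E).
Proof.
have mD : measurable (`](0 : R), +oo[%classic : set (measurableTypeR R)) by [].
rewrite gamma_gamma_pdfE; apply/(measurable_restrictT _ mD).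
apply: emeasurable_funM => //; exact: measurable_bessel_mellin_section.
Qed.

Lemma integral_gamma_gamma_moment k :
  (\int[lebesgue_measure]_x ((`|x| ^+ k)%:E * (gamma_gamma_pdf alpha beta x)%:E) =
   gamma_gamma_norm%:E * bessel_mellin nu r (s + k%:R) 0)%E.
Proof.
rewrite /bessel_mellin -ge0_integralZl//; last 3 first.
- exact: measurable_bessel_mellin_section.
- by move=> x _; apply: integral_ge0 => t _; rewrite lee_fin bessel_mellin_kernel_ge0.
- by rewrite lee_fin gamma_gamma_norm_ge0.
rewrite [RHS]integral_mkcond; apply: eq_integral => x _.
rewrite patchE; case: ifPn => [|].
  rewrite inE/= in_itv/= andbT => x0.
  by rewrite -gamma_gamma_pdf_moment// EFinM ger0_norm// ltW.
rewrite notin_setE/= in_itv/= andbT => /negP; rewrite -leNgt => /gamma_gamma_pdf_le0 ->.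
by rewrite mule0.
Qed.

End gamma_gamma_moments.

(** This is Gamma(alpha + k) Gamma(beta + k) / (Gamma(alpha) Gamma(beta)) times
    (alpha beta)^(- k), expanded by the functional equation of Gamma. *)
Definition gamma_gamma_moment {R : realType} (alpha beta : R) (k : nat) : R :=
  \prod_(i < k) ((alpha + i%:R) * (beta + i%:R) / (alpha * beta)).

Section gamma_gamma_variable.
Context {d : measure_display} {T : measurableType d} {R : realType}.
Variables (P : probability T R) (I : {RV P >-> R}) (alpha beta : R).
Hypotheses (alpha1 : 1 < alpha) (beta1 : 1 < beta) (gI : is_gamma_gamma I alpha beta).
Local Notation nu := (alpha - beta).
Local Notation s := ((alpha + beta) / 2).
Local Notation r := (Num.sqrt (alpha * beta)).

Let alpha0 : 0 < alpha. Proof. exact: lt_trans alpha1. Qed.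
Let beta0 : 0 < beta. Proof. exact: lt_trans beta1. Qed.

(** The case k = 0 says that the density has total mass one.  It yields the
    positivity of the normalising constant and the finiteness of the Mellin
    transform, from which the recurrence gives the other cases. *)
Lemma gamma_gamma_bessel_mellin k : ((gamma_gamma_norm alpha beta)%:E * bessel_mellin nu r (s + k%:R) 0 =
  (gamma_gamma_moment alpha beta k)%:E)%E.
Proof.
have s1 : 1 < s by rewrite ltr_pdivlMr// mul1r (ltrD alpha1 beta1).
have r0 : 0 < r by rewrite sqrtr_gt0 mulr_gt0.
have r2 : r ^+ 2 = alpha * beta by rewrite sqr_sqrtr// mulr_ge0 ?ltW.
have total : ((gamma_gamma_norm alpha beta)%:E * bessel_mellin nu r (s + 0%:R) 0 = 1)%E.
  rewrite -integral_gamma_gamma_moment//.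
  under eq_integral do rewrite expr0 mul1e.
  by rewrite -gI// probability_setT.
have c0 : 0 < gamma_gamma_norm alpha beta.
  rewrite lt_neqAle gamma_gamma_norm_ge0 andbT; apply/eqP => c0.
  by move: total; rewrite -c0 mul0e => -[] /eqP; rewrite eq_sym oner_eq0.
elim: k => [|k IH]; first by rewrite total /gamma_gamma_moment big_ord0.
have sk : 1 < s + k%:R by rewrite (lt_le_trans s1)// lerDl.
have -> : s + k.+1%:R = s + k%:R + 1 by rewrite -addrA natr1.
rewrite (bessel_mellin_rec sk r0 (pmule_EFin_inj c0 IH)).
rewrite -EFinM; congr EFin; rewrite {2}/gamma_gamma_moment big_ord_recr/=.
rewrite -/(gamma_gamma_moment alpha beta k) r2.
have a' := lt0r_neq0 alpha0; have b' := lt0r_neq0 beta0; have c' := lt0r_neq0 c0.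
by field; rewrite a' b' c'.
Qed.

(** Absolute values keep the integrand nonnegative, so that integrability of the
    powers of [I] is a consequence rather than a prerequisite. *)
Lemma gamma_gamma_abs_moment k :
  (\int[P]_w (`|I w| ^+ k)%:E = (gamma_gamma_moment alpha beta k)%:E)%E.
Proof.
rewrite -gamma_gamma_bessel_mellin -integral_gamma_gamma_moment//.
have mf : measurable_fun setT (fun x : R => (`|x| ^+ k)%:E).
  by apply/measurable_EFinP; apply: measurable_funX; exact: normr_measurable.
have f0 (x : R) : (0 <= (`|x| ^+ k)%:E)%E by rewrite lee_fin exprn_ge0.
(* Lebesgue measure lives on the sigma-algebra of [measurableTypeR R], whose
   display differs from that of [R]: [I] is repackaged with that target. *)
have mI : measurable_fun setT (I : T -> measurableTypeR R).
  exact: (@measurable_funP _ _ _ _ setT I).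
pose I' : {mfun T >-> measurableTypeR R} :=
  HB.pack (I : T -> measurableTypeR R) (isMeasurableFun.Build _ _ _ _ _ mI).
rewrite -(ge0_integral_density (nu := distribution P I') (mu := lebesgue_measure)
  (measurable_gamma_gamma_pdf alpha0 beta0) gI mf f0).
by rewrite -(ge0_integral_distribution I' mf f0).
Qed.

Lemma gamma_gamma_ae_gt0 : {ae P, forall w, 0 < I w}.
Proof.
exists (I @^-1` `]-oo, 0]); split.
- by rewrite -[X in measurable X]setTI; exact: measurable_funP.
- rewrite -[LHS]/(distribution P I `]-oo, 0]) (gI (measurable_itv _)).
  apply: integral0_eq => x; rewrite /= in_itv/= => x0.
  by rewrite gamma_gamma_pdf_le0.
- by move=> w /= /negP; rewrite -leNgt in_itv.
Qed.

Lemma gamma_gamma_integrable k : P.-integrable setT (fun w => (I w ^+ k)%:E).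
Proof.
apply/integrableP; split.
  by apply/measurable_EFinP; exact: measurable_funX.
under eq_integral do rewrite /= normrX.
by rewrite gamma_gamma_abs_moment ltry.
Qed.

Lemma expectation_gamma_gamma_moment k :
  ('E_P[fun w => (I w ^+ k)%R] = (gamma_gamma_moment alpha beta k)%:E)%E.
Proof.
rewrite unlock -gamma_gamma_abs_moment; apply: ae_eq_integral => //.
- by apply/measurable_EFinP; exact: measurable_funX.
- apply/measurable_EFinP; apply: measurable_funX; exact: measurableT_comp.
apply: filterS gamma_gamma_ae_gt0 => w w0 _.
by rewrite ger0_norm// ltW.
Qed.

End gamma_gamma_variable.

(** * Central moments, skewness and excess kurtosis *)

Section gamma_gamma_central.
Context {d : measure_display} {T : measurableType d} {R : realType}.
Variables (P : probability T R) (I : {RV P >-> R}) (alpha beta : R).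
Hypotheses (alpha1 : 1 < alpha) (beta1 : 1 < beta) (gI : is_gamma_gamma I alpha beta).
Local Notation m := (gamma_gamma_moment alpha beta).

(** The coefficients are a total function, to allow the binomial coefficients of
    a central moment to be given as a list. *)
Lemma expectation_gamma_gamma_sum n (c : nat -> R) :
  ('E_P[fun w => (\sum_(i < n) c i * I w ^+ i)%R] = (\sum_(i < n) c i * m i)%:E)%E.
Proof.
have L1 i : (fun w => c i * I w ^+ i) \in Lfun P 1.
  apply/Lfun1_integrable.
  apply: eq_integrable (integrableZl measurableT (c i) (gamma_gamma_integrable alpha1 beta1 gI i)) => //.
have S1 k : (fun w => \sum_(i < k) c i * I w ^+ i) \in Lfun P 1.
  elim: k => [|k IH].
    rewrite (_ : (fun _ => _) = cst 0) ?Lfun_cst//.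
    by apply/funext => w; rewrite big_ord0.
  rewrite (_ : (fun _ => _) = (fun w => \sum_(i < k) c i * I w ^+ i) \+ (fun w => c k * I w ^+ k)).
    exact: rpredD.
  by apply/funext => w; rewrite big_ord_recr.
elim: n => [|n IH].
  rewrite (_ : (fun _ => _) = cst 0) ?expectation_cst ?big_ord0//.
  by apply/funext => w; rewrite big_ord0.
rewrite (_ : (fun _ => _) = (fun w => \sum_(i < n) c i * I w ^+ i) \+ (fun w => c n * I w ^+ n)); last first.
  by apply/funext => w; rewrite big_ord_recr.
rewrite expectationD// IH big_ord_recr/= EFinD; congr (_ + _)%E.
rewrite unlock.
under eq_integral do rewrite EFinM.
rewrite integralZl//; last exact: (gamma_gamma_integrable alpha1 beta1 gI n).
have := expectation_gamma_gamma_moment alpha1 beta1 gI n; rewrite unlock => ->.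
by rewrite EFinM.
Qed.

Let a := alpha^-1.
Let b := beta^-1.

Lemma gamma_gamma_momentE k : m k = \prod_(i < k) ((1 + i%:R * a) * (1 + i%:R * b)).
Proof.
apply: eq_bigr => i _; rewrite /a /b.
have alpha0 : alpha != 0 by rewrite gt_eqF// (lt_trans _ alpha1).
have beta0 : beta != 0 by rewrite gt_eqF// (lt_trans _ beta1).
by field; rewrite alpha0 beta0.
Qed.

Lemma gamma_gamma_mean : ('E_P[I] = 1)%E.
Proof.
have := expectation_gamma_gamma_moment alpha1 beta1 gI 1.
by rewrite gamma_gamma_momentE big_ord_recr big_ord0/= !mul0r !addr0 !mul1r.
Qed.

Lemma gamma_gamma_variance : ('V_P[I] = (a + b + a * b)%:E)%E.
Proof.
rewrite /variance unlock gamma_gamma_mean/=.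
have := expectation_gamma_gamma_sum 3 (fun i => nth 0 [:: 1; - 2; 1] i).
rewrite !big_ord_recr !big_ord0/= !gamma_gamma_momentE !big_ord_recr !big_ord0/=.
set v := (X in X%:E) => h; rewrite (_ : a + b + a * b = v); last by rewrite /v; ring.
rewrite -h; congr expectation; apply/funext => w.
by rewrite !big_ord_recr big_ord0 !fctE/=; ring.
Qed.

Let sigma := Num.sqrt (a + b + a * b).

Lemma gamma_gamma_standardized w : standardized P I w = (I w - 1) / sigma.
Proof. by rewrite /standardized gamma_gamma_mean gamma_gamma_variance. Qed.

Lemma gamma_gamma_skewness : skewness P I =
  (((1 + a) * (1 + 2 * a) * (1 + b) * (1 + 2 * b) - 3 * ((1 + a) * (1 + b)) + 2)
   / sigma ^+ 3)%:E.
Proof.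
have := expectation_gamma_gamma_sum 4
  (fun i => nth 0 [:: - 1; 3; - 3; 1] i / sigma ^+ 3).
rewrite !big_ord_recr !big_ord0/= !gamma_gamma_momentE !big_ord_recr !big_ord0/=.
move=> h; rewrite /skewness [LHS](eq_trans _ h).
  by congr EFin; ring.
congr expectation; apply/funext => w.
rewrite gamma_gamma_standardized expr_div_n !big_ord_recr big_ord0/=.
by ring.
Qed.

Lemma gamma_gamma_excess_kurtosis : excess_kurtosis P I =
  (((1 + a) * (1 + 2 * a) * (1 + 3 * a) * ((1 + b) * (1 + 2 * b) * (1 + 3 * b))
     - 4 * ((1 + a) * (1 + 2 * a) * (1 + b) * (1 + 2 * b)) + 6 * ((1 + a) * (1 + b)) - 3)
   / (a + b + a * b) ^+ 2 - 3)%:E.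
Proof.
have ab0 : 0 <= a + b + a * b.
  by rewrite !addr_ge0 ?mulr_ge0 ?invr_ge0 ?(ltW (lt_trans ltr01 alpha1)) ?(ltW (lt_trans ltr01 beta1)).
have s4 : (a + b + a * b) ^+ 2 = sigma ^+ 4 by rewrite -{1}(sqr_sqrtr ab0) -exprM.
have := expectation_gamma_gamma_sum 5
  (fun i => nth 0 [:: 1; - 4; 6; - 4; 1] i / sigma ^+ 4).
rewrite !big_ord_recr !big_ord0/= !gamma_gamma_momentE !big_ord_recr !big_ord0/=.
move=> h; rewrite /excess_kurtosis EFinB s4; congr (_ - _)%E.
rewrite [LHS](eq_trans _ h).
  by congr EFin; ring.
congr expectation; apply/funext => w.
rewrite gamma_gamma_standardized expr_div_n !big_ord_recr big_ord0/=.
by ring.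
Qed.

End gamma_gamma_central.

(** * Uniform estimates and leading terms *)

(** Here p^2 is the variance and q^2 = a + b its leading part, N / q^3 the leading
    term and H the higher-order part of the third central moment.  The errors
    H / p^3 and N / q^3 - N / p^3 are both O(a b / q), and a b / q <= b sqrt b since
    a <= b and sqrt b <= q. *)
Lemma skewness_estimate (R : realType) (a b p q : R) : 0 < a -> a <= b -> b <= 1 ->
  0 < p -> 0 < q -> p ^+ 2 = a + b + a * b -> q ^+ 2 = a + b ->
  `|((1 + a) * (1 + 2 * a) * (1 + b) * (1 + 2 * b) - 3 * ((1 + a) * (1 + b)) + 2) / p ^+ 3
    - 2 * (a ^+ 2 + 3 * (a * b) + b ^+ 2) / q ^+ 3| <= 14 * (b * Num.sqrt b).
Proof.
move=> a0 ab b1 p0 q0 p2 q2; have b0 : 0 < b by exact: lt_le_trans ab.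
set N := 2 * (a ^+ 2 + 3 * (a * b) + b ^+ 2).
pose H := 6 * (a * b) * q ^+ 2 + 4 * (a * b) ^+ 2.
have -> : (1 + a) * (1 + 2 * a) * (1 + b) * (1 + 2 * b) - 3 * ((1 + a) * (1 + b)) + 2 = N + H.
  by rewrite /N /H q2; ring.
have ab0 : 0 < a * b by rewrite mulr_gt0.
have u0 : 0 < Num.sqrt b by rewrite sqrtr_gt0.
have uq : Num.sqrt b <= q.
  rewrite -(@ler_pXn2r _ 2) ?nnegrE ?ltW// sqr_sqrtr ?q2 ?(ltW b0)//; lra.
have qp : q <= p.
  by rewrite -(@ler_pXn2r _ 2) ?nnegrE ?ltW// p2 q2; lra.
have N0 : 0 <= N by rewrite /N; have := sqr_ge0 a; have := sqr_ge0 b; lra.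
have H0 : 0 <= H by rewrite /H; have := sqr_ge0 (a * b); have := mulr_ge0 (ltW ab0) (sqr_ge0 q); lra.
have NE : N <= 5 / 2 * q ^+ 4.
  have -> : q ^+ 4 = (a + b) ^+ 2 by rewrite -q2 -exprM.
  by rewrite /N; have := sqr_ge0 (a - b); lra.
have HE : H <= 10 * (a * b) * q ^+ 2.
  have h : (a * b) * (a * b) <= (a * b) * q ^+ 2.
    rewrite ler_pM2l// q2; have := ler_wpM2r (ltW b0) (le_trans ab b1); lra.
  rewrite /H; lra.
have key : a * b / q <= b * Num.sqrt b.
  rewrite ler_pdivrMr// [a * b]mulrC -mulrA ler_pM2l// (le_trans ab)//.
  by rewrite -{1}(sqr_sqrtr (ltW b0)) expr2 ler_pM2l.
have pq3 : q ^+ 3 <= p ^+ 3 by rewrite ler_pXn2r// nnegrE ltW.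
have abq0 : 0 <= 10 * (a * b / q) by rewrite mulr_ge0// divr_ge0 ?ltW.
have e1 : H / p ^+ 3 <= 10 * (a * b / q).
  rewrite ler_pdivrMr ?exprn_gt0//; apply: (le_trans HE).
  have -> : 10 * (a * b) * q ^+ 2 = 10 * (a * b / q) * q ^+ 3 by field; rewrite gt_eqF.
  exact: ler_wpM2l.
(* p - q = (p^2 - q^2) / (p + q) = a b / (p + q) <= a b / (2 q) *)
have p3q3 : (p ^+ 3 - q ^+ 3) * q <= 3 / 2 * (a * b) * p ^+ 2.
  have d : (p - q) * (p + q) = a * b by rewrite -subr_sqr p2 q2; ring.
  have pq0 : 0 <= p - q by rewrite subr_ge0.
  have -> : p ^+ 3 - q ^+ 3 = (p - q) * (p ^+ 2 + p * q + q ^+ 2) by ring.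
  have h1 : (p - q) * q <= (a * b) / 2 by have := mulr_ge0 pq0 pq0; lra.
  have h2 : p ^+ 2 + p * q + q ^+ 2 <= 3 * p ^+ 2.
    have := ler_pM (ltW q0) (ltW q0) qp qp; have := ler_wpM2l (ltW p0) qp; lra.
  rewrite mulrAC; have h3 : 0 <= p ^+ 2 + p * q + q ^+ 2.
    by rewrite !addr_ge0 ?sqr_ge0// mulr_ge0 ?ltW.
  have := ler_pM (mulr_ge0 pq0 (ltW q0)) h3 h1 h2; lra.
have e2 : N / q ^+ 3 - N / p ^+ 3 <= 4 * (a * b / q).
  have P3 : 0 < p ^+ 3 by rewrite exprn_gt0.
  have Q3 : 0 < q ^+ 3 by rewrite exprn_gt0.
  rewrite -(ler_pM2r (mulr_gt0 (mulr_gt0 P3 Q3) q0)).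
  have -> : (N / q ^+ 3 - N / p ^+ 3) * (p ^+ 3 * q ^+ 3 * q) = N * ((p ^+ 3 - q ^+ 3) * q).
    by field; rewrite !gt_eqF.
  have -> : 4 * (a * b / q) * (p ^+ 3 * q ^+ 3 * q) = 4 * (a * b) * (p ^+ 3 * q ^+ 3).
    by field; rewrite gt_eqF.
  have pq30 : 0 <= (p ^+ 3 - q ^+ 3) * q by rewrite mulr_ge0 ?subr_ge0// ltW.
  apply: (le_trans (ler_pM N0 pq30 NE p3q3)).
  have -> : 5 / 2 * q ^+ 4 * (3 / 2 * (a * b) * p ^+ 2) = 15 / 4 * (a * b) * (p ^+ 2 * q ^+ 3) * q by field.
  have -> : 4 * (a * b) * (p ^+ 3 * q ^+ 3) = 4 * (a * b) * (p ^+ 2 * q ^+ 3) * p by ring.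
  have Y0 : 0 <= (a * b) * (p ^+ 2 * q ^+ 3) by rewrite mulr_ge0 ?mulr_ge0 ?exprn_ge0 ?ltW.
  have := ler_wpM2l Y0 qp; have := mulr_ge0 Y0 (ltW p0); lra.
have e3 : 0 <= N / q ^+ 3 - N / p ^+ 3.
  by rewrite subr_ge0 ler_wpM2l// lef_pV2 ?posrE ?exprn_gt0.
have e4 : 0 <= H / p ^+ 3 by rewrite divr_ge0// exprn_ge0// ltW.
rewrite mulrDl ler_norml; apply/andP; split; lra.
Qed.

(** With V = w + c the variance, the fourth central moment is 3 V^2 + 6 w Q + H with
    H = O(c w^2).  The term 3 V^2 cancels the 3 of the excess kurtosis, H / V^2 is
    O(c), and replacing 6 w Q / V^2 by 6 Q / w costs O(c) because
    V^2 - w^2 = c (2 w + c) and Q = O(w^2); finally c = a b <= b^2. *)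
Lemma kurtosis_estimate (R : realType) (a b : R) : 0 < a -> a <= b -> b <= 1 ->
  `|((1 + a) * (1 + 2 * a) * (1 + 3 * a) * ((1 + b) * (1 + 2 * b) * (1 + 3 * b))
     - 4 * ((1 + a) * (1 + 2 * a) * (1 + b) * (1 + 2 * b)) + 6 * ((1 + a) * (1 + b)) - 3)
     / (a + b + a * b) ^+ 2 - 3
    - 6 * (a ^+ 2 + 5 * (a * b) + b ^+ 2) / (a + b)| <= 200 * b ^+ 2.
Proof.
move=> a0 ab b1; have b0 : 0 < b by exact: lt_le_trans ab.
set w := a + b; set c := a * b; set Q := a ^+ 2 + 5 * c + b ^+ 2.
have c0 : 0 < c by rewrite mulr_gt0.
have w0 : 0 < w by rewrite addr_gt0.
have w2 : w <= 2 by rewrite /w; lra.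
pose H := c * (36 * w ^+ 2 + 30 * c + 66 * c * w + 36 * c ^+ 2).
have QE : Q = w ^+ 2 + 3 * c by rewrite /Q /w /c; ring.
have V0 : 0 < w + c by rewrite addr_gt0.
have -> : (1 + a) * (1 + 2 * a) * (1 + 3 * a) * ((1 + b) * (1 + 2 * b) * (1 + 3 * b))
     - 4 * ((1 + a) * (1 + 2 * a) * (1 + b) * (1 + 2 * b)) + 6 * ((1 + a) * (1 + b)) - 3
   = 3 * (w + c) ^+ 2 + 6 * w * Q + H.
  by rewrite /H QE /w /c; ring.
have cw : 4 * c <= w ^+ 2 by rewrite /c /w; have := sqr_ge0 (a - b); lra.
have c1 : c <= 1 by rewrite /c; have := ler_wpM2l (ltW a0) b1; lra.
have cw1 : c <= w by rewrite /c /w; have := ler_wpM2l (ltW a0) b1; lra.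
have cb2 : c <= b ^+ 2 by rewrite /c expr2 ler_wpM2r// ltW.
have wV : w ^+ 2 <= (w + c) ^+ 2.
  by rewrite ler_pXn2r ?nnegrE ?ltW// ltrDl.
have V2 : 0 < (w + c) ^+ 2 by rewrite exprn_gt0.
have eH : H / (w + c) ^+ 2 <= 90 * c.
  rewrite ler_pdivrMr// /H.
  have h1 : c * w <= w ^+ 2 / 2.
    have := ler_wpM2l (ltW w0) w2; have := ler_pM (ltW c0) (ltW w0) (lexx c) w2; lra.
  have h2 : c ^+ 2 <= w ^+ 2 / 4 by have := ler_wpM2l (ltW c0) c1; lra.
  have h3 : 36 * w ^+ 2 + 30 * c + 66 * c * w + 36 * c ^+ 2 <= 90 * (w + c) ^+ 2 by lra.
  have := ler_wpM2l (ltW c0) h3; lra.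
have eH0 : 0 <= H / (w + c) ^+ 2.
  by rewrite divr_ge0 ?ltW// /H !mulr_gt0// !addr_gt0// ?mulr_gt0 ?exprn_gt0// mulr_gt0.
have eQ : 6 * Q / w - 6 * w * Q / (w + c) ^+ 2 <= 32 * c.
  rewrite -(ler_pM2r (mulr_gt0 w0 V2)).
  have -> : (6 * Q / w - 6 * w * Q / (w + c) ^+ 2) * (w * (w + c) ^+ 2) = 6 * Q * (c * (2 * w + c)).
    by field; rewrite !gt_eqF.
  have h1 : Q <= 7 / 4 * w ^+ 2 by rewrite QE; lra.
  have h2 : c * (2 * w + c) <= c * (3 * w) by rewrite ler_pM2l//; lra.
  have Q0 : 0 <= Q by rewrite QE; have := sqr_ge0 w; lra.
  have c20 : 0 <= c * (2 * w + c) by rewrite mulr_ge0 ?addr_ge0 ?mulr_ge0 ?ltW.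
  have h3 := ler_pM Q0 c20 h1 h2.
  have h4 := ler_wpM2l (mulr_ge0 (ltW c0) (ltW w0)) wV.
  have h5 : 0 <= c * w * w ^+ 2 by rewrite !mulr_ge0 ?sqr_ge0 ?ltW.
  lra.
have eQ0 : 0 <= 6 * Q / w - 6 * w * Q / (w + c) ^+ 2.
  have -> : 6 * Q / w - 6 * w * Q / (w + c) ^+ 2 = 6 * Q * (c * (2 * w + c)) / (w * (w + c) ^+ 2).
    by field; rewrite !gt_eqF.
  have Q0 : 0 <= Q by rewrite QE; have := sqr_ge0 w; lra.
  by rewrite divr_ge0 ?mulr_ge0 ?addr_ge0 ?mulr_ge0 ?ltW.
have -> : (3 * (w + c) ^+ 2 + 6 * w * Q + H) / (w + c) ^+ 2 - 3 - 6 * Q / w =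
    H / (w + c) ^+ 2 - (6 * Q / w - 6 * w * Q / (w + c) ^+ 2).
  by field; rewrite !gt_eqF.
rewrite ler_norml; apply/andP; split; lra.
Qed.

Lemma powR32_sqrt (R : realType) (x : R) : 0 <= x -> x `^ (3 / 2) = Num.sqrt x ^+ 3.
Proof.
by move=> x0; rewrite mulrC powRrM powR12_sqrt// powR_mulrn ?sqrtr_ge0.
Qed.

(** Substituting tau = b / a, all quantities are rational in sqrt a, sqrt b and
    sqrt (a + b). *)
Lemma skewness_leading_term (R : realType) (alpha beta : R) : 0 < alpha -> 0 < beta ->
  let tau := alpha / beta in let a := alpha^-1 in let b := beta^-1 in
  2 * (tau ^+ 2 + 3 * tau + 1) / (Num.sqrt tau * (tau + 1) `^ (3 / 2)) * (1 / Num.sqrt beta) =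
  2 * (a ^+ 2 + 3 * (a * b) + b ^+ 2) / Num.sqrt (a + b) ^+ 3.
Proof.
move=> al0 be0 tau a b.
have a0 : 0 < a by rewrite invr_gt0.
have b0 : 0 < b by rewrite invr_gt0.
have tauE : tau = b / a by rewrite /tau /a /b invrK mulrC.
have -> : 1 / Num.sqrt beta = Num.sqrt b by rewrite /b sqrtrV ?mul1r// ltW.
clearbody tau a b.
have tau0 : 0 <= tau by rewrite tauE divr_ge0 ?ltW.
have tau1E : tau + 1 = (a + b) / a by rewrite tauE; field; rewrite gt_eqF.
rewrite powR32_sqrt ?addr_ge0// tau1E sqrtrM ?addr_ge0 ?ltW//.
rewrite tauE sqrtrM ?(ltW b0)//.
have -> : Num.sqrt a^-1 = (Num.sqrt a)^-1 by rewrite sqrtrV// ltW.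
have v0 : 0 < Num.sqrt a by rewrite sqrtr_gt0.
have u0 : 0 < Num.sqrt b by rewrite sqrtr_gt0.
have q0 : 0 < Num.sqrt (a + b) by rewrite sqrtr_gt0 addr_gt0.
have : a = Num.sqrt a ^+ 2 by rewrite sqr_sqrtr// ltW.
have : b = Num.sqrt b ^+ 2 by rewrite sqr_sqrtr// ltW.
move: v0 u0 q0; move: (Num.sqrt a) (Num.sqrt b) (Num.sqrt (a + b)) => v u q v0 u0 q0 -> ->.
by field; rewrite !gt_eqF.
Qed.

Lemma kurtosis_leading_term (R : realType) (alpha beta : R) : 0 < alpha -> 0 < beta ->
  let tau := alpha / beta in let a := alpha^-1 in let b := beta^-1 in
  6 * (tau ^+ 2 + 5 * tau + 1) / (tau * (tau + 1)) * (1 / beta) =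
  6 * (a ^+ 2 + 5 * (a * b) + b ^+ 2) / (a + b).
Proof.
move=> al0 be0 tau a b; rewrite /tau /a /b.
by field; rewrite !gt_eqF ?addr_gt0.
Qed.

Theorem proposition1 (R : realType) :
  exists C beta0 : R, 0 < C /\ 0 < beta0 /\
    forall alpha beta : R, beta0 <= beta -> beta <= alpha ->
    forall (d : measure_display) (T : measurableType d) (P : probability T R)
      (I : {RV P >-> R}), is_gamma_gamma I alpha beta ->
    let tau := alpha / beta in
    (`| skewness P I
        - (2 * (tau ^+ 2 + 3 * tau + 1)
             / (Num.sqrt tau * (tau + 1) `^ (3 / 2))
           * (1 / Num.sqrt beta))%:E |
      <= (C * beta `^ (- (3 / 2)))%:E)%E
    /\
    (`| excess_kurtosis P I
        - (6 * (tau ^+ 2 + 5 * tau + 1) / (tau * (tau + 1))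
           * (1 / beta))%:E |
      <= (C * beta ^- 2)%:E)%E.
Proof.
(* 14 and 200 come from the two estimates; 2 <= beta gives the 1 < (alpha + beta) / 2
   of the recurrence and b <= 1. *)
exists 200, 2; do 2 split => //.
move=> alpha beta beta2 ab d T P I gI tau.
have beta1 : 1 < beta by rewrite (lt_le_trans _ beta2)// ltr1n.
have alpha1 : 1 < alpha by rewrite (lt_le_trans beta1).
have beta0 : 0 < beta by rewrite (lt_trans _ beta1).
have alpha0 : 0 < alpha by rewrite (lt_trans _ alpha1).
have a0 : 0 < alpha^-1 by rewrite invr_gt0.
have b0 : 0 < beta^-1 by rewrite invr_gt0.
have ab' : alpha^-1 <= beta^-1 by rewrite lef_pV2 ?posrE.
have b1 : beta^-1 <= 1 by rewrite invf_le1// ltW.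
split.
- rewrite (gamma_gamma_skewness alpha1 beta1 gI) skewness_leading_term// -EFinB abse_EFin lee_fin.
  have p0 : 0 < alpha^-1 + beta^-1 + alpha^-1 * beta^-1 by rewrite !addr_gt0 ?mulr_gt0.
  have q0 : 0 < alpha^-1 + beta^-1 by rewrite addr_gt0.
  have : Num.sqrt (alpha^-1 + beta^-1 + alpha^-1 * beta^-1) ^+ 2 = alpha^-1 + beta^-1 + alpha^-1 * beta^-1.
    by rewrite sqr_sqrtr ?ltW.
  have : Num.sqrt (alpha^-1 + beta^-1) ^+ 2 = alpha^-1 + beta^-1 by rewrite sqr_sqrtr ?ltW.
  rewrite -sqrtr_gt0 in p0; rewrite -sqrtr_gt0 in q0.
  move=> q2 p2; apply: le_trans (skewness_estimate a0 ab' b1 p0 q0 p2 q2) _.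
  have -> : beta `^ (- (3 / 2)) = beta^-1 * Num.sqrt beta^-1.
    rewrite powRN powR32_sqrt ?(ltW beta0)// sqrtrV ?(ltW beta0)// exprS invfM mulrC.
    by rewrite sqr_sqrtr// ltW.
  by rewrite ler_wpM2r ?mulr_ge0 ?sqrtr_ge0 ?(ltW b0)// ler_nat.
- rewrite (gamma_gamma_excess_kurtosis alpha1 beta1 gI) kurtosis_leading_term// -EFinB abse_EFin lee_fin.
  by rewrite -[beta ^- 2]exprVn; exact: kurtosis_estimate.
Qed.
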